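(* Let $n\ge 2$ and let $G_1$ and $G_2$, with edge sets $E_1$ and $E_2$, be two interpoint distance based graphs derived from $n$ data points $X_1,X_2,\ldots,X_n$ and $Y_1,Y_2,\ldots,Y_n$ respectively. Let $\pi$ be a permutation chosen uniformly at random from the symmetric group $S_n$, and let $$V_1=\sum_{s\ne t}\mathbf{1}\big((s,t)\in E_1\big)\,\mathbf{1}\big((\pi(s),\pi(t))\in E_2\big).$$ Then for all $t>0$, $$P\left(n^{-3/2}\left(V_1-\frac{4|E_1||E_2|}{n(n-1)}\right)\ge t\right)\le\exp\left(-\frac{nt^2}{64(2n-1)(6+4/n+1/n^2)}\right)$$ and $$P\left(n^{-3/2}\left(V_1-\frac{4|E_1||E_2|}{n(n-1)}\right)\le -t\right)\le\exp\left(-\frac{nt^2}{64(2n-1)(6+4/n+1/n^2)}\right).$$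
   Context: An interpoint distance based graph derived from $n$ data points is a simple undirected graph on the vertex set $\{1,\dots,n\}$ (vertex $i$ corresponding to the $i$th data point) constructed from the pairwise distances between the data points, such as $k$ minimal spanning trees or a $k$ nearest neighbour spanning subgraph. The graphs are treated as fixed, and the only randomness is that of $\pi$. The sum $\sum_{s\neq t}$ runs over ordered pairs $(s,t)$ with $s,t\in\{1,\dots,n\}$, $s\ne t$; $(s,t)\in E_i$ means that $s$ and $t$ are joined by an edge of $G_i$ (a symmetric relation); $|E_i|$ is the number of (unordered) edges, so $|E_i|\le n(n-1)/2$. *)

(* Defs.v *)
From HB Require Import structures.
From mathcomp Require Import all_boot all_order all_algebra all_fingroup.
From mathcomp Require Import all_classical all_reals all_analysis.

Set Implicit Arguments.
Unset Strict Implicit.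
Unset Printing Implicit Defensive.

Import Order.TTheory GRing.Theory Num.Theory.

Local Open Scope classical_set_scope.
Local Open Scope ring_scope.

(* Simple undirected graphs on the vertex set 'I_n; an edge is an unordered
   pair of distinct vertices. *)
Record sgraph (n : nat) := SGraph {
  edges : {set {set 'I_n}};
  edges_card2 : [forall e in edges, #|e| == 2%N] }.

(* "(s, t) \in E": since edges have two elements, [adj G s s] is false. *)
Definition adj (n : nat) (G : sgraph n) : rel 'I_n :=
  fun s t => [set s; t]%SET \in edges G.

(* A rule constructing a graph from an array of pairwise distances. No
   particular rule (k-MST, k-NN, ...) is singled out. *)
Definition graph_rule (R : realType) (n : nat) : Type :=
  ('I_n -> 'I_n -> R) -> sgraph n.

Definition interpoint_graph (R : realType) (n : nat) (M : metricType R)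
    (rule : graph_rule R n) (X : 'I_n -> M) : sgraph n :=
  rule (fun i j => mdist (X i) (X j)).

Definition uniform_permutation (R : realType) (n : nat) (d : measure_display)
    (T : measurableType d) (P : probability T R) (pi : T -> 'S_n) : Prop :=
  forall sigma : 'S_n,
    measurable (pi @^-1` [set sigma]) /\
    P (pi @^-1` [set sigma]) = ((n`!)%:R^-1)%:E.

Definition V1 (n : nat) (G1 G2 : sgraph n) (sigma : 'S_n) : nat :=
  (\sum_(s < n) \sum_(t < n | s != t)
     adj G1 s t * adj G2 (sigma s) (sigma t))%N.

(* Main.v *)
(* Swapping two values of the permutation changes V1 by at most 4n. Any function f
   on a symmetric group that moves by at most c under such swaps is sub-Gaussian:
   averaging f over one uniform transposition [tperm k j] at a time (the Fisher-Yates
   shuffle) leads from f to its mean in n steps, each of which keeps the swap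
   constant c and costs a factor exp (8 theta^2 c^2) in the moment generating
   function, because exp x <= x + exp (2 x^2). Chernoff's bound for n^(-3/2) V1 and
   its opposite gives exp (- t^2 / 512), which is stronger than the bound claimed
   since (2 - 1/n) (6 + 4/n + 1/n^2) >= 9. *)
Require Import Defs.
From HB Require Import structures.
From mathcomp Require Import all_boot all_order all_algebra all_fingroup.
From mathcomp Require Import all_classical all_reals all_analysis.
From mathcomp Require Import ring lra.

Set Implicit Arguments.
Unset Strict Implicit.
Unset Printing Implicit Defensive.

Import Order.TTheory GRing.Theory Num.Theory.

Local Open Scope classical_set_scope.
Local Open Scope ring_scope.

(** * Exponential moments about the mean of a finite family *)

(** For [x >= 1], [x <= 2 * x ^+ 2] suffices. Below 1, the inequality [1 + y <= expR y] at a
    negative multiple of [x] bounds [expR x] by a rational function, which is compared with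
    [1 + x + 2 * x ^+ 2]. *)
Lemma expR_le_id_expR_sqr (R : realType) (x : R) : expR x <= x + expR (2 * x ^+ 2).
Proof.
have le1 : 1 + 2 * x ^+ 2 <= expR (2 * x ^+ 2) by exact: expR_ge1Dx.
have [x1|x1] := leP 1 x.
  apply: (@le_trans _ _ (expR (2 * x ^+ 2))); last by rewrite lerDr; lra.
  by rewrite ler_expR; nra.
have hx : 0 < 1 - x / 2 by lra.
have [x0|x0] := leP x 0.
  have : expR x * (1 - x) <= 1.
    rewrite -[leRHS](expRxMexpNx_1 x) ler_pM2l ?expR_gt0//; exact: expR_ge1Dx.
  have := expR_gt0 x; nra.
(* Halving [x] before squaring keeps the bound finite up to 1, where [1 / (1 - x)] blows up. *)
have h2 : expR (x / 2) * (1 - x / 2) <= 1.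
  rewrite -[leRHS](expRxMexpNx_1 (x / 2)) ler_pM2l ?expR_gt0//; exact: expR_ge1Dx.
have h3 : expR x * (1 - x / 2) ^+ 2 <= 1.
  have -> : expR x = expR (x / 2) ^+ 2 by rewrite -expRM_natl; congr expR; lra.
  rewrite -exprMn; apply: exprn_ile1 => //.
  by rewrite mulr_ge0 ?expR_ge0 ?ltW.
apply: le_trans (_ : 1 + x + 2 * x ^+ 2 <= _); last by lra.
rewrite -(@ler_pM2r _ ((1 - x / 2) ^+ 2)) ?exprn_gt0//.
apply: le_trans h3 _.
(* Half of this product is exactly the excess of [(1 + x + 2 * x ^+ 2) * (1 - x / 2) ^+ 2] over
   1. *)
have : 0 <= x ^+ 2 * ((1 - x) * (5 / 2 - x)).
  by rewrite mulr_ge0 ?sqr_ge0// mulr_ge0//; lra.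
lra.
Qed.

(** After centring at the mean [m], the linear terms of the previous inequality cancel in the sum
    and only the quadratic exponent remains. *)
Lemma sum_expR_le_mean (R : realType) (I : finType) (A : {set I}) (h : I -> R)
    (m b theta : R) :
  \sum_(i in A) h i = #|A|%:R * m ->
  (forall i, i \in A -> `|h i - m| <= b) ->
  \sum_(i in A) expR (theta * h i) <=
    #|A|%:R * (expR (2 * (theta * b) ^+ 2) * expR (theta * m)).
Proof.
move=> hm hb.
have -> : \sum_(i in A) expR (theta * h i) =
    expR (theta * m) * \sum_(i in A) expR (theta * (h i - m)).
  by rewrite big_distrr; apply: eq_bigr => i _ /=; rewrite -expRD; congr expR; ring.
rewrite mulrA [leRHS]mulrC ler_pM2l ?expR_gt0//.
have -> : #|A|%:R * expR (2 * (theta * b) ^+ 2) =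
   \sum_(i in A) (theta * (h i - m) + expR (2 * (theta * b) ^+ 2)).
  rewrite big_split /= -big_distrr /= sumrB hm !sumr_const.
  rewrite -[m *+ _]mulr_natl -[expR _ *+ _]mulr_natl; ring.
apply: ler_sum => i iA; apply: le_trans (expR_le_id_expR_sqr _) _.
rewrite lerD2l ler_expR ler_pM2l// !exprMn ler_wpM2l ?sqr_ge0//.
by rewrite -real_normK ?num_real// ler_sqr ?nnegrE ?(le_trans _ (hb _ iA))// hb.
Qed.

(** * Averaging over one random transposition *)

(** The index [j = k] contributes the identity. When [k] is outside [A], the [tperm k j] represent
    the right cosets of the permutations supported on [A] among those supported on [k |: A]. *)
Definition tperm_mean (R : realType) (T : finType) (A : {set T}) (k : T)
    (f : {perm T} -> R) (s : {perm T}) : R :=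
  #|k |: A|%:R^-1 * \sum_(j in k |: A) f (tperm k j * s)%g.

Lemma card_setU1_neq0 (R : realType) (T : finType) (A : {set T}) (k : T) :
  #|k |: A|%:R != 0 :> R.
Proof. by rewrite pnatr_eq0 -lt0n; apply/card_gt0P; exists k; rewrite !inE eqxx. Qed.

Lemma sum_tperm_mean (R : realType) (T : finType) (A : {set T}) (k : T)
    (f : {perm T} -> R) :
  \sum_s tperm_mean A k f s = \sum_s f s.
Proof.
rewrite -big_distrr /= exchange_big /=.
rewrite (eq_bigr (fun=> \sum_s f s)); last first.
  by move=> j _; rewrite [RHS](reindex_inj (mulgI (tperm k j))).
by rewrite sumr_const -[X in _ * X]mulr_natl mulKf ?card_setU1_neq0.
Qed.

Lemma dist_mean_le (R : realType) (I : finType) (A : {set I}) (h : I -> R) (m b : R) :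
  #|A|%:R != 0 :> R -> (forall i, i \in A -> `|h i - m| <= b) ->
  `|#|A|%:R^-1 * \sum_(i in A) h i - m| <= b.
Proof.
move=> A0 hb; rewrite -[X in _ - X](mulKf A0) -mulrBr.
have -> : #|A|%:R * m = \sum_(i in A) m by rewrite sumr_const mulr_natl.
rewrite -sumrB.
rewrite normrM ger0_norm ?invr_ge0// -[leRHS](mulKf A0) ler_wpM2l ?invr_ge0//.
have -> : #|A|%:R * b = \sum_(i in A) b by rewrite sumr_const mulr_natl.
apply: le_trans (ler_norm_sum _ _ _) _.
exact: ler_sum.
Qed.

Definition tperm_lipschitz (R : realType) (T : finType) (f : {perm T} -> R) (c : R) :=
  forall (s : {perm T}) (x y : T), `|f (tperm x y * s)%g - f s| <= c.

Lemma tperm_mean_lipschitz (R : realType) (T : finType) (A : {set T}) (k : T)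
    (f : {perm T} -> R) (c : R) :
  tperm_lipschitz f c -> tperm_lipschitz (tperm_mean A k f) c.
Proof.
move=> fc s x y; rewrite /tperm_mean -mulrBr -sumrB -[X in `|X|]subr0.
apply: dist_mean_le => [|j _]; first exact: card_setU1_neq0.
(* Conjugation by [tperm k j] turns the swap of [x] and [y] into another swap, so every summand
   moves by at most [c]. *)
have -> : (tperm k j * (tperm x y * s) =
    tperm (tperm k j x) (tperm k j y) * (tperm k j * s))%g.
  by rewrite -tpermJ conjgE tpermV !mulgA -(mulgA _ (tperm k j) (tperm k j))
    tperm2 mulg1.
by rewrite subr0.
Qed.

(** The summand at [j] for [r * s] equals the summand at [r j] for [s]: the two arguments differ by
    a permutation supported on [k |: A] that sends [k] to [j], to [r j] and back to [k], hence is
    supported on [A]. *)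
Lemma tperm_mean_invariant (R : realType) (T : finType) (A : {set T}) (k : T)
    (f : {perm T} -> R) :
  (forall r s, perm_on A r -> f (r * s)%g = f s) ->
  forall r s, perm_on (k |: A) r -> tperm_mean A k f (r * s)%g = tperm_mean A k f s.
Proof.
move=> fA r s rA; congr (_ * _).
rewrite [RHS](reindex_inj (@perm_inj _ r)) /=.
rewrite [RHS](eq_bigl [in k |: A]); last by move=> j; rewrite /= perm_closed.
apply: eq_bigr => j jA.
have -> : (tperm k j * (r * s) =
    (tperm k j * r * tperm k (r j)) * (tperm k (r j) * s))%g.
  by rewrite !mulgA -(mulgA _ (tperm k (r j)) (tperm k (r j))) tperm2 mulg1.
apply: fA; apply/fintype.subsetP => z; rewrite inE /= => zP.
have kkA : k \in k |: A by rewrite !inE eqxx.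
have rj : r j \in k |: A by rewrite perm_closed.
have tA i : i \in k |: A -> perm_on (k |: A) (tperm k i).
  move=> iA; apply: fintype.subset_trans (tperm_on k i) _.
  by apply/fintype.subsetP => u; rewrite !inE => /orP[] /eqP ->; rewrite -in_setU1.
have : perm_on (k |: A) (tperm k j * r * tperm k (r j))%g.
  by rewrite !perm_onM// tA.
move/fintype.subsetP/(_ z zP); rewrite in_setU1 => /predU1P[zk|//].
by move: zP; rewrite zk !permM tpermL tpermR eqxx.
Qed.

Lemma sum_expR_tperm_mean (R : realType) (T : finType) (A : {set T}) (k : T)
    (f : {perm T} -> R) (c theta : R) : tperm_lipschitz f c ->
  \sum_s expR (theta * f s) <=
    expR (8 * (theta * c) ^+ 2) * \sum_s expR (theta * tperm_mean A k f s).
Proof.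
move=> fc; rewrite -(sum_tperm_mean A k) big_distrr /=; apply: ler_sum => s _.
have N0 := card_setU1_neq0 R A k.
have Ngt0 : 0 < #|k |: A|%:R :> R by rewrite lt0r N0 ler0n.
(* The summands and their mean both lie within [c] of [f s], hence within [2 * c] of each other;
   this is where 8 comes from. *)
have -> : expR (8 * (theta * c) ^+ 2) = expR (2 * (theta * (2 * c)) ^+ 2).
  by congr expR; ring.
rewrite /tperm_mean -(ler_pM2l Ngt0) mulVKf//.
apply: sum_expR_le_mean => [|j jA]; first by rewrite mulVKf.
rewrite (_ : 2 * c = c + c); last by ring.
apply: le_trans (ler_distD (f s) _ _) _; apply: lerD; first exact: fc.
by rewrite distrC; apply: dist_mean_le.
Qed.

(** Induction on [r], one averaging step per element: the swap constant and the total are preserved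
    while the group fixing [g] grows. *)
Lemma sum_expR_le_invariant (R : realType) (T : finType) (f : {perm T} -> R)
    (c theta : R) (r : seq T) : tperm_lipschitz f c ->
  exists2 g : {perm T} -> R,
    [/\ tperm_lipschitz g c, \sum_s g s = \sum_s f s &
        forall u s, perm_on [set x in r] u -> g (u * s)%g = g s] &
    \sum_s expR (theta * f s) <=
      expR ((size r)%:R * (8 * (theta * c) ^+ 2)) * \sum_s expR (theta * g s).
Proof.
move=> fc; elim: r => [|k r [g [gc gf gr] fg]].
  exists f; last by rewrite mul0r expR0 mul1r.
  split=> // u s u0; suff -> : u = 1%g by rewrite mul1g.
  by apply/permP => x; rewrite perm1 (out_perm u0)// inE.
exists (tperm_mean [set x in r] k g).
  split; first exact: tperm_mean_lipschitz.
    by rewrite sum_tperm_mean.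
  by move=> u s; rewrite set_cons; apply: tperm_mean_invariant.
have -> : (size (k :: r))%:R = (size r)%:R + 1 :> R by rewrite natr1.
apply: le_trans fg _; rewrite (mulrDl (size r)%:R) mul1r expRD -mulrA ler_pM2l ?expR_gt0//.
exact: sum_expR_tperm_mean.
Qed.

(** * Moment generating function and Chernoff bound on a symmetric group *)

(** Once every point of [T] has been processed, [g] is invariant under all permutations, so it is
    constant, and the preserved total forces its value to be [m]. *)
Lemma perm_mgf_le (R : realType) (T : finType) (f : {perm T} -> R)
    (c theta m : R) : tperm_lipschitz f c -> \sum_s f s = #|{perm T}|%:R * m ->
  \sum_s expR (theta * (f s - m)) <=
    #|{perm T}|%:R * expR (#|T|%:R * (8 * (theta * c) ^+ 2)).
Proof.
move=> fc fm.
have [g [_ gf ginv]] := sum_expR_le_invariant theta (enum T) fc; rewrite -cardT.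
have gE s : g s = g 1%g.
  by rewrite -[RHS](ginv s) ?mulg1//; apply/fintype.subsetP => x _; rewrite inE mem_enum.
have -> : \sum_s expR (theta * g s) = #|{perm T}|%:R * expR (theta * m).
  rewrite (eq_bigr (fun=> expR (theta * g 1%g))); last by move=> s _; rewrite gE.
  rewrite sumr_const mulr_natl; congr (expR (theta * _) *+ _).
  have N0 : #|{perm T}|%:R != 0 :> R.
    by rewrite pnatr_eq0 -lt0n; apply/card_gt0P; exists 1%g.
  apply: (mulfI N0); rewrite -fm -gf (eq_bigr (fun=> g 1%g)) ?sumr_const ?mulr_natl//.
move=> fg.
rewrite (eq_bigr (fun s => expR (- (theta * m)) * expR (theta * f s))); last first.
  by move=> s _; rewrite -expRD; congr expR; ring.
rewrite -big_distrr /= -(ler_pM2l (expR_gt0 (theta * m))) [leLHS]mulrA.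
rewrite expRxMexpNx_1 mul1r.
by apply: le_trans fg _; rewrite le_eqVlt; apply/orP; left; apply/eqP; ring.
Qed.

Lemma perm_concentration (R : realType) (T : finType) (f : {perm T} -> R)
    (c m t : R) : tperm_lipschitz f c -> \sum_s f s = #|{perm T}|%:R * m ->
  0 < #|T|%:R * c ^+ 2 -> 0 <= t ->
  #|[set s | t <= f s - m]%SET|%:R <=
    #|{perm T}|%:R * expR (- (t ^+ 2 / (32 * (#|T|%:R * c ^+ 2)))).
Proof.
move=> fc fm; set v := #|T|%:R * c ^+ 2 => v0 t0.
have vn0 : v != 0 by rewrite gt_eqF.
(* This minimises [8 * theta ^+ 2 * v - theta * t], with minimum [- (t ^+ 2 / (32 * v))]. *)
pose theta := t / (16 * v).
have theta0 : 0 <= theta by rewrite divr_ge0// mulr_ge0 ?ltW.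
rewrite -(ler_pM2l (expR_gt0 (theta * t))).
apply: (@le_trans _ _ (\sum_s expR (theta * (f s - m)))).
  rewrite mulr_natr -sumr_const [leRHS](bigID [in [set s | t <= f s - m]%SET]) /=.
  apply: ler_wpDr; first by apply: sumr_ge0 => s _; exact: expR_ge0.
  by apply: ler_sum => s; rewrite inE => ts; rewrite ler_expR ler_wpM2l.
apply: le_trans (perm_mgf_le _ fc fm) _.
rewrite [leRHS]mulrCA ler_wpM2l// -expRD ler_expR le_eqVlt; apply/orP; left; apply/eqP.
have -> : #|T|%:R * (8 * (theta * c) ^+ 2) = 8 * theta ^+ 2 * v by rewrite /v; ring.
by rewrite /theta; field.
Qed.

(** * The mean of [V1] *)

Lemma sum_adj (n : nat) (G : sgraph n) :
  (\sum_(s < n) \sum_(t < n | s != t) adj G s t = 2 * #|edges G|)%N.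
Proof.
rewrite pair_big_dep /= -big_mkcondr /= sum1dep_card.
have card2 e : e \in edges G -> #|e| = 2%N.
  by move=> eG; apply/eqP; move/forall_inP: (edges_card2 G); apply.
pose h (p : 'I_n * 'I_n) := [set p.1; p.2]%SET.
(* Ordered pairs are grouped by the edge they span; each fibre consists of the two orderings of that
   edge. *)
rewrite -sum1dep_card (partition_big h [in edges G]) /=; last by move=> p /andP[].
rewrite mulnC -sum_nat_const; apply: eq_bigr => e eG.
have /eqP/cards2P[x [y [xy exy]]] := card2 e eG.
rewrite sum1dep_card (_ : [set p | _]%SET = [set (x, y); (y, x)]%SET).
  by rewrite cards2 xpair_eqE (negPf xy).
apply/setP => -[s t]; rewrite !inE !xpair_eqE /h /=.
apply/idP/idP.
  move=> /andP[/andP[st _] /eqP E].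
  have := set21 s t; rewrite E exy !inE; have := set22 s t; rewrite E exy !inE.
  by move: st => /[swap] /orP[]/eqP-> /[swap] /orP[]/eqP->; rewrite ?eqxx ?orbT.
by move=> /orP[]/andP[/eqP-> /eqP->]; rewrite /adj -?exy ?eG ?eqxx ?xy//=;
  rewrite finset.setUC -exy eG eqxx eq_sym xy.
Qed.

Lemma exists_perm2 (T : finType) (x y x' y' : T) : x != y -> x' != y' ->
  exists r : {perm T}, r x = x' /\ r y = y'.
Proof.
(* The second transposition leaves [x'] alone, since [x'] differs from both [tperm x x' y] and
   [y']. *)
move=> xy xy'; exists (tperm x x' * tperm (tperm x x' y) y')%g.
rewrite !permM !tpermL; split=> //.
by rewrite tpermD// 1?eq_sym// -{1}(tpermL x x') inj_eq//; exact: perm_inj.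
Qed.

(** Double counting: by double transitivity the sum over permutations is the same for all ordered
    pairs of distinct points, and each permutation merely permutes these pairs. The form without
    division suits a semiring. *)
Lemma sum_perm2 (R : pzSemiRingType) (T : finType) (b : T -> T -> R) (x y : T) :
  x != y ->
  (#|T| * (#|T| - 1))%:R * \sum_(s : {perm T}) b (s x) (s y) =
    #|{perm T}|%:R * \sum_u \sum_(v | u != v) b u v.
Proof.
move=> xy.
have swap u v : u != v ->
    \sum_(s : {perm T}) b (s u) (s v) = \sum_(s : {perm T}) b (s x) (s y).
  move=> uv; have [r [<- <-]] := exists_perm2 xy uv.
  rewrite [RHS](reindex_inj (mulgI r)) /=.
  by apply: eq_bigr => s _; rewrite !permM.
transitivity (\sum_u \sum_(v | u != v) \sum_(s : {perm T}) b (s u) (s v)).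
  pose C := \sum_(s : {perm T}) b (s x) (s y).
  rewrite [RHS](eq_bigr (fun=> C *+ (#|T| - 1))).
    by rewrite sumr_const mulr_natl -mulrnA mulnC.
  move=> u _; rewrite (eq_bigr (fun=> C)); last by move=> v /swap.
  rewrite sumr_const; congr (_ *+ _).
  rewrite (eq_card (B := predC1 u)); last by move=> v; rewrite !inE eq_sym.
  by rewrite cardC1 subn1.
transitivity (\sum_(s : {perm T}) \sum_u \sum_(v | u != v) b (s u) (s v)).
  by rewrite [RHS]exchange_big; apply: eq_bigr => u _; rewrite [RHS]exchange_big.
rewrite (eq_bigr (fun=> \sum_u \sum_(v | u != v) b u v)).
  by rewrite sumr_const mulr_natl.
move=> s _; rewrite [RHS](reindex_inj (@perm_inj _ s)) /=; apply: eq_bigr => u _.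
rewrite [RHS](reindex_inj (@perm_inj _ s)) /=; apply: eq_bigl => v.
by rewrite inj_eq//; exact: perm_inj.
Qed.

Lemma sum_V1 (R : realType) (n : nat) (G1 G2 : sgraph n) : (2 <= n)%N ->
  \sum_s (V1 G1 G2 s)%:R = #|'S_n|%:R *
    (4 * #|edges G1|%:R * #|edges G2|%:R / (n%:R * (n%:R - 1))) :> R.
Proof.
move=> n2.
have n0 : n%:R != 0 :> R by rewrite pnatr_eq0; case: n n2 {G1 G2}.
have n1 : n%:R - 1 != 0 :> R.
  by rewrite subr_eq0 (eqr_nat R n 1); case: n n2 {G1 G2 n0} => [|[]].
have adjR (G : sgraph n) :
    \sum_(s < n) \sum_(t < n | s != t) (adj G s t)%:R = 2 * #|edges G|%:R :> R.
  rewrite -natrM -sum_adj natr_sum; apply: eq_bigr => s _.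
  by rewrite natr_sum.
have -> : \sum_s (V1 G1 G2 s)%:R =
    \sum_(s < n) \sum_(t < n | s != t) (adj G1 s t)%:R *
      \sum_(p : 'S_n) (adj G2 (p s) (p t))%:R :> R.
  under eq_bigr => p _ do (rewrite natr_sum; under eq_bigr do rewrite natr_sum).
  rewrite exchange_big; apply: eq_bigr => s _; rewrite exchange_big.
  by apply: eq_bigr => t _; rewrite big_distrr; apply: eq_bigr => p _; rewrite natrM.
pose C : R := #|'S_n|%:R * (2 * #|edges G2|%:R) / (n%:R * (n%:R - 1)).
under eq_bigr => s _.
  under eq_bigr => t st.
    have -> : \sum_(p : 'S_n) (adj G2 (p s) (p t))%:R = C.
      have := sum_perm2 (fun u v => (adj G2 u v)%:R : R) st.
      rewrite adjR card_ord natrM natrB ?(ltnW n2)// => E.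
      by apply: (canRL (mulfK _)); rewrite ?mulf_neq0// mulrC.
    over.
  rewrite -big_distrl; over.
rewrite /= -big_distrl /= adjR /C; ring.
Qed.

(** * The effect of a swap on [V1] *)

Lemma V1_lipschitz (R : realType) (n : nat) (G1 G2 : sgraph n) (s : 'S_n)
    (x y : 'I_n) :
  `|(V1 G1 G2 (tperm x y * s)%g)%:R - (V1 G1 G2 s)%:R| <= 4 * n%:R :> R.
Proof.
pose A := [set x; y]%SET.
have cA : (\sum_(u < n) (u \in A) <= 2)%N.
  by rewrite -big_mkcond /= sum1_card cards2; case: (x != y).
(* Only pairs meeting [A] can change, each by at most 1. The majorant counts pairs inside [A] twice
   and totals at most [n * 2 + n * 2]. *)
apply: (@le_trans _ _ (\sum_(u < n) \sum_(v < n) ((u \in A) + (v \in A))%:R)).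
  rewrite /V1 !natr_sum -sumrB; apply: le_trans (ler_norm_sum _ _ _) _.
  apply: ler_sum => u _; rewrite !natr_sum -sumrB.
  apply: le_trans (ler_norm_sum _ _ _) _; rewrite big_mkcond; apply: ler_sum => v _.
  case: ifP => // _; rewrite !permM.
  have [uA|uA] := boolP (u \in A); last have [vA|vA] := boolP (v \in A).
  - apply: (@le_trans _ _ 1); last by rewrite ler1n.
    by case: adj; case: adj; case: adj;
      rewrite ?subrr ?normr0 ?subr0 ?sub0r ?normrN ?normr1.
  - by case: adj; case: adj; case: adj;
      rewrite ?subrr ?normr0 ?subr0 ?sub0r ?normrN ?normr1.
  - move: uA vA; rewrite !inE !negb_or => /andP[ux uy] /andP[vx vy].
    by rewrite !tpermD 1?eq_sym// subrr normr0.
rewrite (eq_bigr (fun u => (\sum_(v < n) ((u \in A) + (v \in A)))%:R)); last first.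
  by move=> u _; rewrite natr_sum.
rewrite -natr_sum -natrM ler_nat.
under eq_bigr do rewrite big_split sum_nat_const card_ord /=.
rewrite big_split /= sum_nat_const card_ord -big_distrr /=.
have le2 : (n * \sum_(u < n) (u \in A) <= n * 2)%N by rewrite leq_mul2l cA orbT.
by rewrite (_ : 4 * n = n * 2 + n * 2)%N ?leq_add// -mulnDr mulnC.
Qed.

(** * From counting permutations to probabilities *)

Lemma uniform_permutation_card (R : realType) (n : nat) (d : measure_display)
    (T : measurableType d) (P : probability T R) (pi : T -> 'S_n)
    (A : {set 'S_n}) : uniform_permutation P pi ->
  P [set w | pi w \in A] = (#|A|%:R / #|{perm 'I_n}|%:R)%:E.
Proof.
move=> pi_unif.
(* The event is a finite disjoint union of fibres of [pi], each measurable of mass [1 / n!]. *)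
have -> : [set w | pi w \in A] = \bigcup_(s in [set` A]) pi @^-1` [set s].
  by apply/seteqP; split=> [w wA|w [s sA] /= ->//]; exists (pi w).
rewrite measure_fin_bigcup//; last 2 first.
- by move=> i j _ _ [w [<- <-]].
- by move=> s _; case: (pi_unif s).
have <- := @bigfs _ _ _ _ (enum A) (mem A); last 2 first.
- exact: enum_uniq.
- by move=> s sA; rewrite mem_enum => /negP[]; exact: sA.
rewrite big_enum_cond /= (eq_bigl [in A]); last by move=> s; exact: andbb.
rewrite (eq_bigr (fun=> ((n`!)%:R^-1)%:E)); last first.
  by move=> s _; case: (pi_unif s).
rewrite sumEFin sumr_const -[_ *+ _]mulr_natl; congr (_ / _%:R)%:E.
by rewrite -card_Sn; apply: eq_card => s; rewrite !inE.
Qed.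

Lemma uniform_permutation_concentration (R : realType) (n : nat)
    (d : measure_display) (T : measurableType d) (P : probability T R)
    (pi : T -> 'S_n) (f : 'S_n -> R) (c m t : R) :
  uniform_permutation P pi -> tperm_lipschitz f c ->
  \sum_s f s = #|{perm 'I_n}|%:R * m -> 0 < n%:R * c ^+ 2 -> 0 <= t ->
  (P [set w | (t <= f (pi w) - m)%R] <=
    (expR (- (t ^+ 2 / (32 * (n%:R * c ^+ 2)))))%:E)%E.
Proof.
move=> pi_unif fc fm c0 t0.
have := @perm_concentration R _ f c m t fc fm; rewrite card_ord => /(_ c0 t0) le.
rewrite (_ : [set w | _] = [set w | pi w \in [set s | t <= f s - m]%SET]).
  rewrite uniform_permutation_card// lee_fin ler_pdivrMr.
    by rewrite mulrC.
  by rewrite ltr0n; apply/card_gt0P; exists 1%g.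
by apply/seteqP; split=> w; rewrite /= inE.
Qed.

Theorem proposition4p2 (R : realType) (n : nat) (n_ge2 : (2 <= n)%N)
    (M1 M2 : metricType R) (X : 'I_n -> M1) (Y : 'I_n -> M2)
    (rule1 rule2 : graph_rule R n)
    (d : measure_display) (T : measurableType d) (P : probability T R)
    (pi : T -> 'S_n) (pi_unif : uniform_permutation P pi)
    (t : R) (t_gt0 : 0 < t) :
  let G1 := interpoint_graph rule1 X in
  let G2 := interpoint_graph rule2 Y in
  let W (w : T) : R := n%:R `^ (- (3 / 2)) *
    ((V1 G1 G2 (pi w))%:R
     - 4 * #|edges G1|%:R * #|edges G2|%:R / (n%:R * (n%:R - 1))) in
  let bound := expR (- (n%:R * t ^+ 2 /
    (64 * (2 * n%:R - 1) * (6 + 4 / n%:R + 1 / n%:R ^+ 2)))) in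
  (P [set w | (W w >= t)%R] <= bound%:E)%E /\
  (P [set w | (W w <= - t)%R] <= bound%:E)%E.
Proof.
move=> G1 G2 W bound.
have n0 : 0 < n%:R :> R by rewrite ltr0n (ltnW n_ge2).
have n2 : 2 <= n%:R :> R by rewrite ler_nat.
pose r : R := n%:R `^ (- (3 / 2)).
have r_ge0 : 0 <= r by exact: powR_ge0.
(* Since [r ^+ 2] is [n] to the power -3, the variance proxy is free of [n], and the exponent
   becomes [t ^+ 2 / (32 * 16)]. *)
have r2 : n%:R * (r * (4 * n%:R)) ^+ 2 = 16.
  have -> : n%:R * (r * (4 * n%:R)) ^+ 2 = 16 * (r ^+ 2 * n%:R ^+ 3) by ring.
  rewrite -[r ^+ 2]powR_mulrn// -[_ ^+ 3]powR_mulrn ?ltW// -powRrM -powRD.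
    by rewrite (_ : _ + _ = 0) ?powRr0 ?mulr1//; lra.
  by apply/implyP => _; rewrite gt_eqF.
pose m : R := 4 * #|edges G1|%:R * #|edges G2|%:R / (n%:R * (n%:R - 1)).
(* The sign [e] treats both tails at once: [e = 1] gives the upper one and [e = -1] the lower
   one. *)
have tail (e : R) : `|e| = 1 ->
    (P [set w | (t <= e * W w)%R] <= bound%:E)%E.
  move=> e1; pose f (s : 'S_n) : R := e * r * (V1 G1 G2 s)%:R.
  have fc : tperm_lipschitz f (r * (4 * n%:R)).
    move=> s x y; rewrite /f -mulrBr !normrM e1 mul1r ger0_norm// ler_wpM2l//.
    exact: V1_lipschitz.
  have fm : \sum_s f s = #|{perm 'I_n}|%:R * (e * r * m).
    by rewrite -big_distrr /= sum_V1// mulrCA.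
  have := uniform_permutation_concentration pi_unif fc fm.
  rewrite r2 => /(_ t ltac:(lra) (ltW t_gt0)).
  have -> : [set w | t <= f (pi w) - e * r * m] = [set w | t <= e * W w].
    by apply/funext => w /=; rewrite /f -mulrBr -mulrA.
  move/le_trans; apply; rewrite lee_fin ler_expR lerN2.
  have i0 : 0 < n%:R^-1 :> R by rewrite invr_gt0.
  have den : 0 < 64 * (2 * n%:R - 1) * (6 + 4 / n%:R + 1 / n%:R ^+ 2) :> R.
    by rewrite !mulr_gt0//; lra.
  rewrite ler_pdivrMr// mulrAC ler_pdivlMr; last lra.
  rewrite [leLHS]mulrAC [leRHS]mulrC ler_pM2r ?exprn_gt0//.
  (* Keeping only the 6 of the last factor is enough: [512 * n <= 384 * (2 * n - 1)] holds as soon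
     as [n >= 3 / 2]. *)
  apply: (@le_trans _ _ (64 * (2 * n%:R - 1) * 6)); first lra.
  rewrite ler_wpM2l ?mulr_ge0//; first lra.
  by rewrite -addrA lerDl addr_ge0 ?divr_ge0 ?exprn_ge0 ?ltW.
split; first by have := tail 1 (normr1 _); under eq_set do rewrite mul1r.
have := tail (-1); rewrite normrN1 => /(_ erefl).
by under eq_set do rewrite mulN1r lerNr.
Qed.
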